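(* Let $m\ge 9$ be an integer and let $S_m=\langle m,m+1,\dots,2m-5\rangle$. Then $S_m$ is not $\lambda$-minimal.
   Context: $\mathbb{N}=\{0,1,2,\dots\}$. A numerical set is a subset $T\subseteq\mathbb{N}$ with $0\in T$ and finite complement in $\mathbb{N}$. Its gaps are the elements of $\mathrm{G}(T)=\mathbb{N}\setminus T$; the largest gap is the Frobenius number $\mathrm{F}(T)$. A numerical semigroup is a numerical set closed under addition. $\langle n_1,\dots,n_t\rangle$ denotes the set of all linear combinations of $n_1,\dots,n_t$ with coefficients in $\mathbb{N}$. The enumeration $\lambda(T)$ of a numerical set $T$ is the integer partition whose Young diagram has as its profile (lower-right boundary) the lattice walk that, for $n=0,1,2,\dots,\mathrm{F}(T)$, takes a unit step right if $n\in T$ and a unit step up if $n\notin T$. Equivalently, the parts of $\lambda(T)$ are the numbers $\#\{u\in T: u<x\}$, one for each gap $x\in\mathrm{G}(T)$. The size $|\lambda|$ of a partition is the sum of its parts. The hook length of a box in the Young diagram of a partition $\lambda$ is the number of boxes to its right in the same row plus the number of boxes below it in the same column plus $1$; $\mathrm{H}(\lambda)$ is the set of all hook lengths of $\lambda$. For a numerical semigroup $S$, $\mathcal{P}(S)=\{\lambda:\mathrm{H}(\lambda)=\mathbb{N}\setminus S\}$; it is known that $\lambda(S)\in\mathcal{P}(S)$. $S$ is $\lambda$-minimal if $|\lambda(S)|\le|\lambda|$ for all $\lambda\in\mathcal{P}(S)$. *)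

(* Defs.v *)
From mathcomp Require Import all_boot finmap.
From mathcomp Require Import boolp classical_sets functions cardinality.
From mathcomp Require Import zify.

Set Implicit Arguments.
Unset Strict Implicit.
Unset Printing Implicit Defensive.

Local Open Scope classical_set_scope.

Definition numerical_set (T : set nat) : Prop := T 0 /\ finite_set (~` T).

Definition numerical_semigroup (S : set nat) : Prop :=
  numerical_set S /\ (forall x y, S x -> S y -> S (x + y)).

Definition gen (ns : seq nat) : set nat :=
  [set x | exists c : 'I_(size ns) -> nat,
             x = \sum_(i < size ns) c i * nth 0 ns i].

(* Integer partitions are weakly decreasing lists of positive parts; part
   number i is the length of row i of the Young diagram, row 0 on top. *)
Definition int_partition (l : seq nat) : bool := sorted geq l && (0 \notin l).

Definition young_diagram (l : seq nat) : set (nat * nat) :=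
  [set b | b.2 < nth 0 l b.1].

(* Arm of (i, j) plus leg of (i, j) plus 1: the boxes below (i, j) are the
   (i', j) with i < i' and j < nth 0 l i'. *)
Definition hook_length (l : seq nat) (b : nat * nat) : nat :=
  (nth 0 l b.1 - b.2.+1) + count (fun r => b.2 < r) (drop b.1.+1 l) + 1.

Definition hooks (l : seq nat) : set nat := hook_length l @` young_diagram l.

Definition count_below (T : set nat) (x : nat) : nat :=
  count (fun u => u \in T) (iota 0 x).

(* fset_set A is the finite set with the elements of A when A is finite, and a
   default value otherwise: enumeration T is meaningful only for numerical
   sets T. *)
Definition enumeration (T : set nat) : seq nat :=
  sort geq [seq count_below T x | x <- fset_set (~` T)].

Definition hook_partitions (S : set nat) : set (seq nat) :=
  [set l | int_partition l /\ hooks l = ~` S].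

Definition lambda_minimal (S : set nat) : Prop :=
  forall l, hook_partitions S l -> sumn (enumeration S) <= sumn l.

Definition interval_semigroup (m : nat) : set nat :=
  gen (index_iota m (2 * m - 5).+1).

Lemma enumeration_int_partition (T : set nat) :
  numerical_set T -> int_partition (enumeration T).
Proof.
move=> [T0 Tfin]; apply/andP; split.
  by apply: sort_sorted => x y; rewrite /geq /= leq_total.
rewrite mem_sort; apply/mapP => -[[|x]]; rewrite in_fset_set// inE /=.
  by move=> /(_ T0).
by move=> _; rewrite /count_below /= mem_set.
Qed.

Lemma genD (ns : seq nat) x y : gen ns x -> gen ns y -> gen ns (x + y).
Proof.
move=> [c ->] [d ->]; exists (fun i => c i + d i).
by rewrite -big_split; apply: eq_bigr => i _; rewrite mulnDl.
Qed.

Lemma gen0 (ns : seq nat) : gen ns 0.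
Proof. by exists (fun=> 0); rewrite big1. Qed.

Lemma gen_mem (ns : seq nat) x : x \in ns -> gen ns x.
Proof.
move=> xns; have ltx : index x ns < size ns by rewrite index_mem.
exists (fun i => i == Ordinal ltx); rewrite (bigD1 (Ordinal ltx))//= eqxx mul1n.
by rewrite nth_index// big1 ?addn0// => i /negbTE ->.
Qed.

Lemma genM (ns : seq nat) k x : gen ns x -> gen ns (k * x).
Proof.
by move=> gx; elim: k => [|k IHk]; [exact: gen0 | rewrite mulSn; exact: genD].
Qed.

Lemma interval_semigroup_numerical (m : nat) :
  9 <= m -> numerical_semigroup (interval_semigroup m).
Proof.
move=> m9; split; last by move=> x y; exact: genD.
split; first exact: gen0.
apply: (@sub_finite_set _ _ `I_(m * m)); last exact: finite_II.
move=> n /= nS; rewrite ltnNge; apply/negP => mn; apply: nS.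
have r_lt : n %% m < m by rewrite ltn_mod; lia.
have q_ge : m <= n %/ m by rewrite leq_divRL; lia.
have -> : n = (n %/ m - n %% m) * m + (n %% m) * m.+1.
  by rewrite {1}(divn_eq n m); nia.
by apply: genD; apply: genM; apply: gen_mem; rewrite mem_index_iota; lia.
Qed.

(* Main.v *)
Require Import Defs.
From mathcomp Require Import all_boot.
From mathcomp Require Import finmap boolp classical_sets functions cardinality.
From mathcomp Require Import zify.

(** Multiples of the generating interval give the blocks [[k m, k (2 m - 5)]],
    and [m >= 9] is exactly what makes the blocks for [k >= 2] overlap or touch.
    The gaps of [S_m] are therefore [1, ..., m - 1] and the four numbers
    [2 m - 4, ..., 2 m - 1] ([interval_semigroup_gapE]).  Below each of the
    first [m - 1] gaps lies the element [0], below each of the last four lie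
    the [m - 3] elements [0, m, ..., 2 m - 5], so the enumeration of [S_m] has
    size at least (in fact, equal to) [(m - 1) + 4 (m - 3) = 5 m - 13]
    ([sumn_enumeration_ge]).

    A smaller competitor comes from enlarging [S_m] to the numerical set
    [T = S_m U {1, 2 m - 4, 2 m - 2}].  The hook lengths of the enumeration of
    a numerical set are the differences [x - u > 0] with [x] a gap and [u] an
    element.  The gaps of [T] are [2, ..., m - 1], [2 m - 3] and [2 m - 1], and
    the gaps [2 m - 4] and [2 m - 2] of [S_m], lost in [T], reappear as the
    differences [(2 m - 3) - 1] and [(2 m - 1) - 1]; no element of [S_m] appears
    as a difference.  The enumeration of [T] has parts [m], [m - 1] and [m - 2]
    times [2]; this is [competitor m], and its hook lengths are computed
    directly ([hooks_competitor]).  Its size [4 m - 5] is less than [5 m - 13]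
    as soon as [m > 8]. *)

Set Implicit Arguments.
Unset Strict Implicit.
Unset Printing Implicit Defensive.

Local Open Scope classical_set_scope.

(** * The gaps of the interval semigroup *)

(** A sum of [k] generators lies between [k] times the least generator and [k]
    times the largest one. *)
Lemma interval_semigroup_block m n : interval_semigroup m n ->
  exists k, k * m <= n <= k * (2 * m - 5).
Proof.
move=> [c ->]; exists (\sum_i c i); rewrite !big_distrl /=.
set ns := index_iota _ _ in c *.
have range (i : 'I_(size ns)) : m <= nth 0 ns i <= 2 * m - 5.
  by have := mem_nth 0 (ltn_ord i); rewrite mem_index_iota ltnS.
by apply/andP; split; apply: leq_sum => i _; rewrite leq_mul2l;
  case/andP: (range i) => lo hi; rewrite ?lo ?hi orbT.
Qed.

Lemma interval_semigroup_generator m n :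
  m <= n -> n <= 2 * m - 5 -> interval_semigroup m n.
Proof. by move=> mn nm; apply: gen_mem; rewrite mem_index_iota ltnS mn. Qed.

(** The sums of two generators already fill [2 m, ..., 3 m - 1], because
    [3 m - 1 <= 2 (2 m - 5)]; the larger numbers follow by adding copies of the
    generator [m]. *)
Lemma interval_semigroup_ge m n :
  9 <= m -> 2 * m <= n -> interval_semigroup m n.
Proof.
move=> m9; elim/ltn_ind: n => n IHn mn.
have [n3m|n3m] := ltnP n (3 * m).
  (* split the excess n - 2 m between the two generators *)
  have -> : n = (m + minn (n - 2 * m) (m - 5)) + (m + (n - 2 * m - (m - 5))).
    lia.
  by apply: genD; apply: interval_semigroup_generator; lia.
have -> : n = m + (n - m) by lia.
apply: genD; first by apply: interval_semigroup_generator; lia.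
by apply: IHn; lia.
Qed.

Lemma interval_semigroup_gapE m n : 9 <= m ->
  (~` interval_semigroup m) n <-> (0 < n < m) || (2 * m - 4 <= n < 2 * m).
Proof.
move=> m9; split=> [nS|ngap /interval_semigroup_block[k]].
  apply: contra_notT nS => nS.
  have [->|n0] := posnP n; first exact: gen0.
  have [mn|nm] := leqP (2 * m) n; first exact: interval_semigroup_ge.
  by apply: interval_semigroup_generator; lia.
by case: k => [|[|k]]; nia.
Qed.

(** * The size of the enumeration of the semigroup *)

Lemma size_le_count_below (T : set nat) x (s : seq nat) :
  uniq s -> (forall u, u \in s -> u < x /\ T u) -> size s <= count_below T x.
Proof.
move=> s_uniq sT; rewrite /count_below -size_filter.
apply: uniq_leq_size => // u /sT[ux Tu].
by rewrite mem_filter mem_iota ux !andbT; exact: mem_set.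
Qed.

Lemma sumn_map_ge (f : nat -> nat) c (s : seq nat) :
  (forall x, x \in s -> c <= f x) -> size s * c <= sumn (map f s).
Proof.
elim: s => //= a s IHs fs; rewrite mulSn leq_add //.
  by apply: fs; rewrite mem_head.
by apply: IHs => x xs; apply: fs; rewrite in_cons xs orbT.
Qed.

Lemma perm_gaps_interval_semigroup m : 9 <= m ->
  perm_eq (fset_set (~` interval_semigroup m))
          (iota 1 (m - 1) ++ iota (2 * m - 4) 4).
Proof.
move=> m9; have [[_ Sfin] _] := interval_semigroup_numerical m9.
apply: uniq_perm; first exact: fset_uniq.
  rewrite cat_uniq !iota_uniq andbT; apply/hasPn => x.
  by rewrite !mem_iota; lia.
move=> x; rewrite in_fset_set // mem_cat !mem_iota.
apply/idP/idP => [|xgap].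
  by move/set_mem/(interval_semigroup_gapE _ m9); lia.
by apply: mem_set; apply/(interval_semigroup_gapE _ m9); lia.
Qed.

Lemma sumn_enumeration_ge m : 9 <= m ->
  5 * m - 13 <= sumn (enumeration (interval_semigroup m)).
Proof.
move=> m9; set S := interval_semigroup m.
rewrite (perm_sumn (permEl (perm_sort _ _))).
rewrite (perm_sumn (perm_map _ (perm_gaps_interval_semigroup m9))).
rewrite map_cat sumn_cat.
have low : size (iota 1 (m - 1)) * 1 <=
    sumn [seq count_below S x | x <- iota 1 (m - 1)].
  apply: sumn_map_ge => x; rewrite mem_iota => xm.
  apply: (@size_le_count_below _ _ [:: 0]) => // u.
  by rewrite inE => /eqP ->; split; [lia | exact: gen0].
have high : size (iota (2 * m - 4) 4) * (m - 3) <=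
    sumn [seq count_below S x | x <- iota (2 * m - 4) 4].
  apply: sumn_map_ge => x; rewrite mem_iota => xm.
  have -> : m - 3 = size (0 :: iota m (m - 4)) by rewrite /= size_iota; lia.
  apply: size_le_count_below => [|u].
    by rewrite /= iota_uniq mem_iota; lia.
  rewrite inE mem_iota => /orP[/eqP ->|um]; first by split; [lia|exact: gen0].
  by split; [lia | apply: interval_semigroup_generator; lia].
by apply: leq_trans (leq_add low high); rewrite !size_iota; lia.
Qed.

(** * A smaller partition with the same hook lengths *)

Definition competitor (m : nat) : seq nat := m :: m - 1 :: nseq (m - 2) 2.

Lemma int_partition_competitor m : 3 <= m -> int_partition (competitor m).
Proof.
move=> m3; rewrite /int_partition /competitor !inE mem_nseq.
apply/andP; split; last lia.
have twos k : path geq 2 (nseq k 2) by elim: k.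
have -> : nseq (m - 2) 2 = 2 :: nseq (m - 3) 2.
  by have -> : m - 2 = (m - 3).+1 by lia.
by rewrite /= twos /geq /=; lia.
Qed.

Lemma sumn_competitor m : 3 <= m -> sumn (competitor m) = 4 * m - 5.
Proof. by move=> m3; rewrite /= sumn_nseq; lia. Qed.

Lemma hook_length_competitor0 m j : 3 <= m -> j < m ->
  hook_length (competitor m) (0, j) =
    if j < 2 then 2 * m - 1 - j else m + 1 - j - (j == m - 1).
Proof.
by move=> m3 jm; rewrite /hook_length /= count_nseq; case: (ltnP j 2) => j2; lia.
Qed.

Lemma hook_length_competitor1 m j : 3 <= m -> j < m - 1 ->
  hook_length (competitor m) (1, j) =
    if j < 2 then 2 * m - 3 - j else m - 1 - j.
Proof.
by move=> m3 jm; rewrite /hook_length /= drop0 count_nseq; case: (ltnP j 2) => j2; lia.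
Qed.

Lemma hook_length_competitorSS m i j : j < 2 -> i < m - 2 ->
  hook_length (competitor m) (i.+2, j) = m - 1 - i - j.
Proof.
move=> j2 im; rewrite /hook_length /= drop_nseq count_nseq nth_nseq im.
lia.
Qed.

Lemma hooks_competitor m : 9 <= m ->
  hooks (competitor m) = ~` interval_semigroup m.
Proof.
move=> m9; apply/seteqP; split => n.
  move=> [[i j] /= ij <-]; apply/(interval_semigroup_gapE _ m9).
  case: i ij => [|[|i]]; rewrite /young_diagram /= => ij.
  - by rewrite hook_length_competitor0; try case: ifP; lia.
  - by rewrite hook_length_competitor1; try case: ifP; lia.
  move: ij; rewrite nth_nseq; case: ifP => // im j2.
  by rewrite hook_length_competitorSS; lia.
move=> /(interval_semigroup_gapE _ m9) ngap.
suff [[i j] bY <-] : exists2 b, young_diagram (competitor m) b &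
    hook_length (competitor m) b = n by exists (i, j).
(* The two longest rows carry the large hooks in their first two columns, the
   first column below them carries 2, ..., m - 1, and 1 ends the first row. *)
have [n1|n1] := eqVneq n 1.
  exists (0, m - 1); first by rewrite /young_diagram /=; lia.
  by rewrite hook_length_competitor0; try case: ifP; lia.
have [nm|mn] := ltnP n m.
  exists ((m - 1 - n).+2, 0).
    by rewrite /young_diagram /= nth_nseq ifT; lia.
  by rewrite hook_length_competitorSS; lia.
have [n2|n2] := ltnP n (2 * m - 2).
  exists (1, 2 * m - 3 - n); first by rewrite /young_diagram /=; lia.
  by rewrite hook_length_competitor1; try case: ifP; lia.
exists (0, 2 * m - 1 - n); first by rewrite /young_diagram /=; lia.
by rewrite hook_length_competitor0; try case: ifP; lia.
Qed.

Theorem theorem1p3 (m : nat) (hm : 9 <= m) :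
  ~ lambda_minimal (interval_semigroup m).
Proof.
move=> /(_ (competitor m)) minS.
have := sumn_enumeration_ge hm.
have : sumn (enumeration (interval_semigroup m)) <= sumn (competitor m).
  apply: minS; split; last exact: hooks_competitor.
  by apply: int_partition_competitor; lia.
by rewrite sumn_competitor; lia.
Qed.
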